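(* For every integer $2\leq p<\infty$ and every unitary matrix $A\in\mathcal{U}_p(\mathbb{C})$, the Bogolubov automorphism $\lambda_A$ of $\mathcal{O}_p$ admits at most one extension $\widetilde{\lambda_A}$ to an automorphism of $\mathcal{Q}_p$.
   Context: For an integer $2\leq p<\infty$, the $p$-adic ring $C^*$-algebra $\mathcal{Q}_p$ is the universal $C^*$-algebra generated by a unitary $u$ and an isometry $s_p$ subject to $s_pu=u^ps_p$ and $\sum_{i=0}^{p-1}u^is_ps_p^*u^{-i}=1$. The isometries $T_i=u^is_p$, $0\leq i\leq p-1$, generate a copy of the Cuntz algebra $\mathcal{O}_p$ inside $\mathcal{Q}_p$. For a unitary matrix $A=(a_{i,j})_{0\leq i,j\leq p-1}\in\mathcal{U}_p(\mathbb{C})$, the Bogolubov automorphism $\lambda_A$ of $\mathcal{O}_p$ is determined by $\lambda_A(T_i)=\sum_{j=0}^{p-1}a_{j,i}T_j$. *)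

(* Defs.v *)
From HB Require Import structures.
From mathcomp Require Import all_boot all_order all_algebra.
From mathcomp Require Import all_classical all_reals all_analysis.
From mathcomp Require Import complex.

Set Implicit Arguments.
Unset Strict Implicit.
Unset Printing Implicit Defensive.

Import Order.TTheory GRing.Theory Num.Theory.
Import numFieldNormedType.Exports.

Local Open Scope classical_set_scope.
Local Open Scope ring_scope.

(* Unital C*-algebras over the complex numbers R[i].  The norm of the library
   takes its values in the nonnegative reals of R[i].  The ring structure cannot
   be a parent next to CompleteNormedModule (a ring with a norm is inferred to
   be a numDomainType), so the product is a field of the record, and the carrier
   is equipped with its algType structure afterwards.  As in algType, the zero
   algebra is excluded; every universal property below holds trivially for
   morphisms into it. *)
Record cstarAlgType (R : realType) := CStarAlg {
  cstar_banach : completeNormedModType R[i] ;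
  cstar_one : cstar_banach ;
  cstar_mul : cstar_banach -> cstar_banach -> cstar_banach ;
  cstar_star : cstar_banach -> cstar_banach ;
  cstar_mulA : associative cstar_mul ;
  cstar_mul1x : left_id cstar_one cstar_mul ;
  cstar_mulx1 : right_id cstar_one cstar_mul ;
  cstar_mulDl : left_distributive cstar_mul +%R ;
  cstar_mulDr : right_distributive cstar_mul +%R ;
  cstar_one_neq0 : cstar_one != 0 ;
  cstar_scaleAl : forall (a : R[i]) (x y : cstar_banach),
    a *: cstar_mul x y = cstar_mul (a *: x) y ;
  cstar_scaleAr : forall (a : R[i]) (x y : cstar_banach),
    a *: cstar_mul x y = cstar_mul x (a *: y) ;
  cstar_starK : involutive cstar_star ;
  cstar_starD : {morph cstar_star : x y / x + y} ;
  cstar_starZ : forall (a : R[i]) (x : cstar_banach),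
    cstar_star (a *: x) = Num.conj a *: cstar_star x ;
  cstar_starM : forall x y : cstar_banach,
    cstar_star (cstar_mul x y) = cstar_mul (cstar_star y) (cstar_star x) ;
  cstar_normM : forall x y : cstar_banach,
    `|cstar_mul x y| <= `|x| * `|y| ;
  cstar_identity : forall x : cstar_banach,
    `|cstar_mul (cstar_star x) x| = `|x| ^+ 2
}.

Definition cstar_sort (R : realType) (A : cstarAlgType R) : Type :=
  cstar_banach A.
Coercion cstar_sort : cstarAlgType >-> Sortclass.

HB.instance Definition _ (R : realType) (A : cstarAlgType R) :=
  CompleteNormedModule.copy (cstar_sort A) (cstar_banach A).

HB.instance Definition _ (R : realType) (A : cstarAlgType R) :=
  GRing.Zmodule_isNzRing.Build (cstar_sort A)
    (@cstar_mulA R A) (@cstar_mul1x R A) (@cstar_mulx1 R A)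
    (@cstar_mulDl R A) (@cstar_mulDr R A) (@cstar_one_neq0 R A).

HB.instance Definition _ (R : realType) (A : cstarAlgType R) :=
  GRing.Lmodule_isLalgebra.Build R[i] (cstar_sort A)
    (@cstar_scaleAl R A).

HB.instance Definition _ (R : realType) (A : cstarAlgType R) :=
  GRing.Lalgebra_isAlgebra.Build R[i] (cstar_sort A)
    (@cstar_scaleAr R A).

Definition star (R : realType) (A : cstarAlgType R) (x : A) : A :=
  cstar_star x.

Definition star_hom (R : realType) (A B : cstarAlgType R) (f : A -> B) : Prop :=
  [/\ linear f, GRing.monoid_morphism f & {morph f : x / star x}].

Definition star_automorphism (R : realType) (A : cstarAlgType R) (f : A -> A)
    : Prop :=
  star_hom f /\ bijective f.

Definition cstar_subalgebra (R : realType) (A : cstarAlgType R) (D : set A)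
    : Prop :=
  [/\ closed D, D 1,
      forall (a : R[i]) (x y : A), D x -> D y -> D (a *: x + y),
      forall x y : A, D x -> D y -> D (x * y) &
      forall x : A, D x -> D (star x)].

Definition cstar_generated (R : realType) (A : cstarAlgType R) (G : set A)
    : Prop :=
  forall D : set A, cstar_subalgebra D -> G `<=` D -> D = setT.

Definition unitary (R : realType) (A : cstarAlgType R) (u : A) : Prop :=
  star u * u = 1 /\ u * star u = 1.

Definition isometry (R : realType) (A : cstarAlgType R) (s : A) : Prop :=
  star s * s = 1.

(* For unitary u, u^{-i} is (star u) ^+ i. *)
Definition padic_relations (p : nat) (R : realType) (A : cstarAlgType R)
    (u s : A) : Prop :=
  [/\ unitary u, isometry s, s * u = u ^+ p * s &
      \sum_(i < p) u ^+ i * s * star s * star u ^+ i = 1].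

(* (Q, u, s) is the p-adic ring C*-algebra with its canonical generators. *)
Definition is_padic_algebra (p : nat) (R : realType) (Q : cstarAlgType R)
    (u s : Q) : Prop :=
  [/\ padic_relations p u s,
      cstar_generated [set x | x = u \/ x = s] &
      forall (B : cstarAlgType R) (v t : B), padic_relations p v t ->
        exists! f : Q -> B, [/\ star_hom f, f u = v & f s = t]].

Definition cuntz_relations (p : nat) (R : realType) (A : cstarAlgType R)
    (T : 'I_p -> A) : Prop :=
  (forall i, isometry (T i)) /\ \sum_(i < p) T i * star (T i) = 1.

(* (Op, T) is the Cuntz algebra O_p with its canonical generators. *)
Definition is_cuntz_algebra (p : nat) (R : realType) (Op : cstarAlgType R)
    (T : 'I_p -> Op) : Prop :=
  [/\ cuntz_relations T,
      cstar_generated (range T) &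
      forall (B : cstarAlgType R) (V : 'I_p -> B), cuntz_relations V ->
        exists! f : Op -> B, star_hom f /\ (forall i, f (T i) = V i)].

(* iota realizes Op as the copy of O_p in Q generated by the u^i s. *)
Definition is_cuntz_inclusion (p : nat) (R : realType) (Op Q : cstarAlgType R)
    (T : 'I_p -> Op) (u s : Q) (iota : Op -> Q) : Prop :=
  [/\ star_hom iota, injective iota & forall i, iota (T i) = u ^+ i * s].

Definition is_bogolubov (p : nat) (R : realType) (Op : cstarAlgType R)
    (T : 'I_p -> Op) (A : 'M[R[i]]_p) (lambda : Op -> Op) : Prop :=
  star_automorphism lambda /\
  forall i, lambda (T i) = \sum_(j < p) A j i *: T j.

Definition automorphism_extension (R : realType) (Op Q : cstarAlgType R)
    (iota : Op -> Q) (lambda : Op -> Op) (alpha : Q -> Q) : Prop :=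
  star_automorphism alpha /\ forall x : Op, alpha (iota x) = iota (lambda x).

(* Main.v *)
Require Import Defs.
From mathcomp Require Import all_boot all_order all_algebra.
From mathcomp Require Import all_classical all_reals all_analysis.
From mathcomp Require Import complex ring zify.

Set Implicit Arguments.
Unset Strict Implicit.
Unset Printing Implicit Defensive.

Import Order.TTheory GRing.Theory Num.Theory.
Import numFieldNormedType.Exports.

Local Open Scope ring_scope.

(** An extension [alpha] is a star-homomorphism on an algebra generated by [u]
    and [s], and [alpha s] is prescribed because [s = iota (T 0)]; so only
    [alpha u] has to be determined. Two extensions agree on every [u^i s] with
    [i < p]. Hence the ratio of [alpha u] and [beta u], minus [1], is invariant
    under [x |-> t x (star t)] with [t = beta s]; pulled back by [beta], it
    becomes an element [d] with [s d (star s) = d]. Everything rests on the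
    rigidity statement [fixed_eq0]: such a [d] is zero.

    In the representation on l2(Z) given by [u e_k = e_(k+1)] and
    [s e_k = e_(p k)], an invariant [d] is a multiple of the rank-one projection
    on [e_0], and the claim is that the algebra contains no such projection. What
    survives of this picture without a representation is that [x u^k y = 0]
    whenever [x] and [y] are invariant and [k != 0] ([fixed_orthogonal]).

    The contradiction comes from a sequence that is almost central, namely
    [G = sum_(n < N) u^(p^n)]. Its commutator with [u] is zero, and that with
    [s] telescopes, so on the star-algebra generated by [u] and [s] the
    commutators with [G] are bounded independently of [N]
    ([bounded_commutators_dense]). On the other hand [G] displaces [d]
    completely: with [D = star d], the orthogonality gives [D G d (star G) D = 0]
    but [D d G (star G) D = N (D d D)]. If [d] is approximated by an element
    [y] of the star-algebra, [G] can be moved across [y] at bounded cost, and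
    the approximation error is controlled because [G (star G) D] has norm
    [O(N)] although [G] itself may have norm [N]; here it matters that the
    differences of distinct powers of [p] are pairwise distinct
    ([lacunary_square]). For [N] large this forces [D d D = 0], so [d = 0].

    The orthogonality of invariant elements needs [(star s) u^r s = 0] for
    [0 < r < p], that is, that isometries whose range projections sum to [1]
    have orthogonal ranges ([isometries_orthogonal]). This is obtained without
    spectral theory, from the fact that [1] is an extreme point of the unit
    ball, proved by a doubling argument. *)

(** * Elementary facts on C*-algebras *)

Lemma natR_bound (R : realType) (x : R[i]) :
  0 <= x -> exists n : nat, x <= n%:R.
Proof.
case: x => a b; rewrite lecE /= => /andP[/eqP -> a0].
exists (Num.bound a); rewrite -(rmorph_nat (real_complex R)) lecE /= eqxx /=.
exact/ltW/archi_boundP.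
Qed.

Section CStarBasics.
Variables (R : realType) (Q : cstarAlgType R).
Implicit Types x y h : Q.

Lemma cnormM x y : `|x * y| <= `|x| * `|y|.
Proof. exact: cstar_normM. Qed.

Lemma cnorm_star_mul x : `|star x * x| = `|x| ^+ 2.
Proof. exact: cstar_identity. Qed.

Lemma starK x : star (star x) = x.
Proof. exact: cstar_starK. Qed.

Lemma starM x y : star (x * y) = star y * star x.
Proof. exact: cstar_starM. Qed.

Lemma starD x y : star (x + y) = star x + star y.
Proof. exact: cstar_starD. Qed.

Lemma starZ (a : R[i]) x : star (a *: x) = Num.conj a *: star x.
Proof. exact: cstar_starZ. Qed.

Lemma star0 : star (0 : Q) = 0.
Proof. by apply: (addrI (star 0)); rewrite -starD !addr0. Qed.

Lemma starN x : star (- x) = - star x.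
Proof. by apply: (addrI (star x)); rewrite -starD !subrr star0. Qed.

Lemma starB x y : star (x - y) = star x - star y.
Proof. by rewrite starD starN. Qed.

Lemma star1 : star (1 : Q) = 1.
Proof. by rewrite -[LHS]mulr1 -{2}(starK 1) -starM mulr1 starK. Qed.

Lemma star_sum (I : Type) (r : seq I) (P : pred I) (f : I -> Q) :
  star (\sum_(i <- r | P i) f i) = \sum_(i <- r | P i) star (f i).
Proof. by apply: (big_morph _ starD star0). Qed.

Lemma starX x n : star (x ^+ n) = star x ^+ n.
Proof. by elim: n => [|n IH]; rewrite ?expr0 ?star1 // exprS starM IH exprSr. Qed.

Lemma cnorm1 : `|1 : Q| = 1.
Proof.
have := cnorm_star_mul 1; rewrite star1 mulr1 expr2 => /esym.
by rewrite -[X in _ = X]mulr1 => /mulfI; apply; rewrite normr_eq0 oner_neq0.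
Qed.

Lemma star_mul_eq0 x : star x * x = 0 -> x = 0.
Proof.
move=> e; apply/eqP; rewrite -normr_eq0 -sqrf_eq0 -cnorm_star_mul e.
by rewrite normr0.
Qed.

Lemma cnorm_star_le x : `|x| <= `|star x|.
Proof.
have [->|x0] := eqVneq x 0; first by rewrite star0.
have := cnormM (star x) x; rewrite cnorm_star_mul expr2.
by rewrite ler_pM2r // normr_gt0.
Qed.

Lemma cnorm_star x : `|star x| = `|x|.
Proof.
by apply/le_anti; rewrite cnorm_star_le -{2}(starK x) cnorm_star_le.
Qed.

Lemma cnorm_isometry x : star x * x = 1 -> `|x| = 1.
Proof.
move=> xi; have := cnorm_star_mul x; rewrite xi cnorm1 => /esym/eqP.
by rewrite sqrp_eq1 ?normr_ge0 // => /eqP.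
Qed.

Lemma cnorm_selfadjoint_sqr x : star x = x -> `|x * x| = `|x| ^+ 2.
Proof. by move=> xs; rewrite -cnorm_star_mul xs. Qed.

Lemma cnormM_le1 x y : `|x| <= 1 -> `|y| <= 1 -> `|x * y| <= 1.
Proof.
move=> x1 y1; apply: le_trans (cnormM x y) _.
by rewrite -[X in _ <= X]mulr1; apply: ler_pM.
Qed.

Lemma cnorm_midpoint x y z :
  `|x| <= 1 -> `|y| <= 1 -> x + y = z *+ 2 -> `|z| <= 1.
Proof.
move=> x1 y1 e; rewrite -(ler_pMn2r (n := 2)) // -normrMn -e.
by apply: le_trans (ler_normD x y) _; apply: lerD.
Qed.

Lemma mul_affine (a c : R[i]) h :
  (1 + a *: h) * (1 + c *: h) = 1 + (a + c) *: h + (a * c) *: (h * h).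
Proof.
rewrite mulrDl mul1r mulrDr mulr1 -scalerAl -scalerAr scalerA.
by rewrite [a + c]addrC scalerDl !addrA.
Qed.

(** Passing from [a] to [(1 - i) a] multiplies [`|a|] by [sqrt 2] and keeps
    the perturbation in the unit ball, because in the average of the two
    squares the terms of order two cancel. *)
Lemma unit_ball_step (a : R[i]) h :
  `|1 + a *: h| <= 1 -> `|1 + (a * - 'i) *: h| <= 1 ->
  `|1 + (a * (1 - 'i)) *: h| <= 1.
Proof.
move=> ha hb.
apply: (cnorm_midpoint (cnormM_le1 ha ha) (cnormM_le1 hb hb)).
rewrite !mul_affine addrACA -[X in _ + X]scalerDl -!(expr2 (_ : R[i])).
have -> : a ^+ 2 + (a * - 'i) ^+ 2 = 0.
  by rewrite exprMn sqrrN sqrCi mulrN1 subrr.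
rewrite scale0r addr0 addrACA -scalerDl mulrnDl -mulr2n scalerMnl.
by congr (_ + _ *: h); rewrite mulrDr mulr1 mulrnDl !mulr2n.
Qed.

(** Bohnenblust-Karlin: [1] is an extreme point of the unit ball.  The steps
    above can be repeated for ever, so that [1 + a h] stays in the unit ball for
    arbitrarily large [a]. *)
Lemma unit_extreme_four h :
  (forall k, `|1 + (- 'i) ^+ k *: h| <= 1) -> h = 0.
Proof.
move=> h4.
have hn n k : `|1 + ((1 - 'i) ^+ n * (- 'i) ^+ k) *: h| <= 1.
  elim: n k => [|n IH] k; first by rewrite mul1r.
  rewrite exprSr -mulrA [(1 - 'i) * _]mulrC mulrA.
  by apply: unit_ball_step; rewrite ?IH // -mulrA -exprSr.
apply/eqP/negP => /negP h0.
have hpos : 0 < `|h| by rewrite normr_gt0.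
have [n hn2] := natR_bound (divr_ge0 (ler0n _ 2) (ltW hpos)).
have := hn (2 * n)%N 0%N; rewrite mulr1 => hle.
have : `|(1 - 'i : R[i]) ^+ (2 * n)| * `|h| <= 2.
  rewrite -normrZ; set z := _ *: h in hle *.
  rewrite -[z](addKr 1) addrC; apply: le_trans (ler_normB _ _) _.
  by rewrite cnorm1 -[X in _ <= X]/(1 + 1 : R[i]) lerD2r.
have -> : `|(1 - 'i : R[i]) ^+ (2 * n)| = 2 ^+ n.
  rewrite exprM sqrrB sqrCi expr1n mul1r normrX; congr (_ ^+ _).
  have -> : 1 - 'i *+ 2 - 1 = - ('i *+ 2) :> R[i].
    by rewrite addrAC subrr add0r.
  by rewrite normrN normrMn normCi.
rewrite -ler_pdivlMr //; apply/negP.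
have lt : 2 / `|h| < 2 ^+ n.
  by apply: le_lt_trans hn2 _; rewrite -natrX ltr_nat ltn_expl.
by rewrite lt_geF.
Qed.

(** In the self-adjoint case the two real directions suffice, because
    [`|1 + i h|^2 = `|1 + h^2|] and [1 + h^2] is the average of [(1 + h)^2]
    and [(1 - h)^2]. *)
Lemma unit_extreme_selfadjoint h :
  star h = h -> `|1 + h| <= 1 -> `|1 - h| <= 1 -> h = 0.
Proof.
move=> hs hp hm.
have hsq : `|1 + h * h| <= 1.
  apply: (cnorm_midpoint (cnormM_le1 hp hp) (cnormM_le1 hm hm)).
  have := mul_affine 1 1 h; have := mul_affine (-1) (-1) h.
  rewrite mulrNN mul1r !scaleN1r !scale1r => -> ->.
  rewrite addrACA [X in X + _]addrACA -[X in _ + X + _]scalerDl -opprD subrr.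
  by rewrite scale0r addr0 -!mulr2n mulrnDl.
have him (c : R[i]) : c * Num.conj c = 1 -> c + Num.conj c = 0 ->
    `|1 + c *: h| <= 1.
  move=> c1 c0; rewrite -(@expr_le1 _ 2) // -cnorm_star_mul starD star1 starZ hs.
  by rewrite mul_affine [_ + c]addrC [_ * c]mulrC c0 c1 scale0r addr0 scale1r.
apply: unit_extreme_four => k.
have -> : (- 'i : R[i]) ^+ k = (- 'i) ^+ (k %% 4).
  rewrite {1}(divn_eq k 4) exprD mulnC exprM.
  by rewrite (exprM _ 2 2) sqrrN sqrCi sqrrN !expr1n mul1r.
have ci : Num.conj (- 'i : R[i]) = 'i by rewrite rmorphN /= conjCi opprK.
have := ltn_pmod k (isT : 0 < 4)%N; move: (k %% 4)%N => [|[|[|[|//]]]] _.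
- by rewrite expr0 scale1r.
- by apply: him; rewrite expr1 ci ?addNr // mulNr -expr2 sqrCi opprK.
- by rewrite sqrrN sqrCi scaleN1r.
- rewrite exprS sqrrN sqrCi mulrN1 opprK.
  by apply: him; rewrite conjCi ?subrr // mulrN -expr2 sqrCi opprK.
Qed.

End CStarBasics.

(** * Isometries whose range projections sum to one *)

Section OrthogonalRanges.
Variables (R : realType) (Q : cstarAlgType R).

(** The condition [`|1 - 2 c| <= 1] says that a self-adjoint [c] has its
    spectrum in [[0, 1]].  The two unit-ball estimates for
    [h = 2 (c i) / #|I|] follow from the triangle inequality, once [c i] is
    written as minus the sum of the other terms. *)
Lemma contractive_sum_eq0 (I : finType) (c : I -> Q) :
  (forall k, star (c k) = c k) -> (forall k, `|1 - c k *+ 2| <= 1) ->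
  \sum_k c k = 0 -> forall i, c i = 0.
Proof.
move=> cs c1 c0 i.
pose n : R[i] := #|I|%:R.
have n0 : 0 < n by rewrite ltr0n; apply/card_gt0P; exists i.
have sum1 (f : I -> Q) : (forall k, `|f k| <= 1) -> `|\sum_k f k| <= n.
  move=> f1; apply: le_trans (ler_norm_sum _ _ _) _.
  by rewrite /n -sum1_card natr_sum; apply: ler_sum => k _; apply: f1.
have one_le : `|1 : Q| <= 1 by rewrite cnorm1.
have sumc : \sum_k (1 - c k *+ 2) = (#|I|%:R : Q).
  by rewrite sumrB sumrMnl c0 mul0rn subr0 sumr_const.
have scaled (x : Q) : `|#|I|%:R + x| <= n -> `|1 + n^-1 *: x| <= 1.
  move=> hx; have -> : 1 + n^-1 *: x = n^-1 *: (#|I|%:R + x).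
    rewrite scalerDr; congr (_ + _).
    rewrite -[(#|I|%:R : Q)]scaler_nat scalerA mulVf ?scale1r //.
    exact: lt0r_neq0.
  rewrite normrZ ger0_norm ?invr_ge0 ?(ltW n0) //.
  by rewrite mulrC ler_pdivrMr // mul1r.
suff : n^-1 *: (c i *+ 2) = 0.
  move/eqP; rewrite scaler_eq0 invr_eq0 (negbTE (lt0r_neq0 n0)) /=.
  by rewrite -scaler_nat scaler_eq0 pnatr_eq0 => /eqP.
apply: unit_extreme_selfadjoint.
- by rewrite starZ mulr2n starD cs fmorphV rmorph_nat.
- apply: scaled.
  have -> : #|I|%:R + c i *+ 2 = \sum_k (if k == i then 1 else 1 - c k *+ 2) :> Q.
    rewrite -sumc (bigD1 i) //= [in RHS](bigD1 i) //= eqxx addrAC.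
    by congr (_ + _); [exact: subrK | apply: eq_bigr => k /negbTE ->].
  by apply: sum1 => k; case: ifP.
- rewrite -scalerN; apply: scaled.
  have -> : #|I|%:R - c i *+ 2 = \sum_k (if k == i then 1 - c k *+ 2 else 1) :> Q.
    rewrite -[_%:R]sumr_const (bigD1 i) //= [in RHS](bigD1 i) //= eqxx addrAC.
    by congr (_ + _); apply: eq_bigr => k /negbTE ->.
  by apply: sum1 => k; case: ifP.
Qed.

Lemma cnorm_reflection (P : Q) :
  star P = P -> P * P = P -> `|1 - P *+ 2| <= 1.
Proof.
move=> sP PP; rewrite cnorm_isometry // starB star1 mulr2n starD sP -mulr2n.
rewrite mulrBr mulr1 mulrBl mul1r mulrnAr mulrnAl PP opprB.
by rewrite [_ *+ 2 *+ 2]mulr2n addrK subrK.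
Qed.

(** Compress the reflections [1 - 2 P k], where [P k] is the range projection
    of [T k], by the isometry [T j]: the compressions of the [P k] with
    [k != j] are contractive and sum to [0]. *)
Lemma isometries_orthogonal (I : finType) (T : I -> Q) :
  (forall i, star (T i) * T i = 1) -> \sum_i T i * star (T i) = 1 ->
  forall i j, i != j -> star (T i) * T j = 0.
Proof.
move=> Ti T1 i j ij.
pose c k := star (T j) * (T k * star (T k)) * T j.
have cs k : star (c k) = c k by rewrite /c !starM !starK !mulrA.
have c1 k : `|1 - c k *+ 2| <= 1.
  have -> : 1 - c k *+ 2 = star (T j) * (1 - (T k * star (T k)) *+ 2) * T j.
    by rewrite mulrBr mulr1 mulrBl Ti mulrnAr mulrnAl.
  have hj : `|T j| <= 1 by rewrite cnorm_isometry.
  apply: cnormM_le1 => //; apply: cnormM_le1; first by rewrite cnorm_star.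
  apply: cnorm_reflection; first by rewrite starM starK.
  by rewrite -mulrA (mulrA (star _)) Ti mul1r.
have cj : c j = 1 by rewrite /c mulrA Ti mul1r Ti.
have sc : \sum_k (if k == j then 0 else c k) = 0.
  apply: (addrI (c j)); rewrite addr0 [X in _ = X]cj.
  have <- : \sum_k c k = 1.
    by rewrite /c -mulr_suml -mulr_sumr T1 mulr1 Ti.
  rewrite [in RHS](bigD1 j) //= [in LHS](bigD1 j) //= eqxx add0r.
  by congr (_ + _); apply: eq_bigr => k /negbTE ->.
have ci : c i = 0.
  have := contractive_sum_eq0 _ _ sc i; rewrite (negbTE ij); apply=> k.
  - by case: ifP; rewrite ?star0.
  - by case: ifP; rewrite // mul0rn subr0 cnorm1.
by apply: star_mul_eq0; rewrite -ci /c starM starK !mulrA.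
Qed.

End OrthogonalRanges.

(** * Elements fixed by conjugation with the isometry *)

Section FixedElements.
Variables (R : realType) (Q : cstarAlgType R).

Lemma norm_orthogonal_sum (I : finType) (P : pred I) (f : I -> Q) (y : Q) :
  (forall i j, P i -> P j ->
     star (f i) * f j = if i == j then star y * y else 0) ->
  `|\sum_(i | P i) f i| ^+ 2 = #|P|%:R * `|y| ^+ 2.
Proof.
move=> fij; rewrite -!cnorm_star_mul star_sum mulr_suml.
rewrite (eq_bigr (fun=> star y * y)); last first.
  move=> i Pi; rewrite mulr_sumr (bigD1 i) //= fij // eqxx big1 ?addr0 //.
  by move=> j /andP[Pj ji]; rewrite fij // eq_sym (negbTE ji).
by rewrite sumr_const normrMn mulr_natl.
Qed.

Lemma star_fixed (s x : Q) : s * x * star s = x -> s * star x * star s = star x.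
Proof. by move=> e; rewrite -{2}e !starM starK mulrA. Qed.

Lemma unitary_expK (u : Q) k : unitary u -> star u ^+ k * u ^+ k = 1.
Proof.
move=> [uu _]; elim: k => [|k IH]; first by rewrite mul1r.
by rewrite exprSr exprS -mulrA (mulrA (star u)) uu mul1r.
Qed.

Lemma unitary_star (u : Q) : unitary u -> unitary (star u).
Proof. by move=> [uu uu']; split; rewrite starK. Qed.

Lemma unitary_expVK (u : Q) k : unitary u -> u ^+ k * star u ^+ k = 1.
Proof. by move=> /unitary_star /(unitary_expK k); rewrite starK. Qed.

Lemma unitary_exp_comm (u : Q) a b :
  unitary u -> star u ^+ b * u ^+ a = u ^+ a * star u ^+ b.
Proof.
by move=> [uu uu']; apply: commrX; apply/commr_sym/commrX; rewrite /GRing.comm uu uu'.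
Qed.

Lemma unitary_exp_cancel (u : Q) a b c : unitary u ->
  u ^+ (a + c) * star u ^+ (c + b) = u ^+ a * star u ^+ b.
Proof.
by move=> uU; rewrite !exprD -mulrA (mulrA (u ^+ c)) unitary_expVK // mul1r.
Qed.

Lemma intertwine_exp (p : nat) (s w : Q) k :
  s * w = w ^+ p * s -> s * w ^+ k = w ^+ (p * k) * s.
Proof.
move=> sw; elim: k => [|k IH]; first by rewrite muln0 mulr1 mul1r.
by rewrite exprSr mulrA IH -mulrA sw mulrA -exprD mulnSr.
Qed.

Variables (p : nat) (u s : Q).
Hypothesis p_ge2 : (2 <= p)%N.
Hypothesis rel : padic_relations p u s.

Lemma ranges_orthogonal r : (0 < r < p)%N -> star s * u ^+ r * s = 0.
Proof.
have [uU ss _ sum1] := rel; move=> /andP[r0 rp].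
have p0 : (0 < p)%N := ltn_trans r0 rp.
have Ti (i : 'I_p) : star (u ^+ i * s) * (u ^+ i * s) = 1.
  by rewrite starM starX -mulrA (mulrA (star u ^+ i)) unitary_expK // mul1r.
have T1 : \sum_(i < p) u ^+ i * s * star (u ^+ i * s) = 1.
  by rewrite -sum1; apply: eq_bigr => i _; rewrite starM starX !mulrA.
have := isometries_orthogonal Ti T1 (i := Ordinal p0) (j := Ordinal rp).
rewrite /= mul1r mulrA; apply.
by rewrite -val_eqE /= neq_ltn r0.
Qed.

(** The compression [s^* u^k s] vanishes unless [p] divides [k], and then it is
    [u^(k / p)]; as [x] and [y] absorb [s] and its adjoint, this
    divides [k] by [p] until it is no longer divisible. *)
Lemma fixed_exp_orthogonal k (x y : Q) : (0 < k)%N ->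
  s * x * star s = x -> s * y * star s = y -> x * u ^+ k * y = 0.
Proof.
have [uU ss su _] := rel; move=> k0 xF yF.
elim/ltn_ind: k k0 => k IH k0.
have e : x * u ^+ k * y = s * x * (star s * u ^+ k * s) * y * star s.
  by rewrite -{1}xF -{1}yF !mulrA.
have usq : u ^+ k * s = u ^+ (k %% p) * s * u ^+ (k %/ p).
  by rewrite {1}(divn_eq k p) addnC exprD -!mulrA mulnC (intertwine_exp _ su).
rewrite {}e -(mulrA (star s)) usq !mulrA.
have [r0|r0] := posnP (k %% p).
  rewrite r0 mulr1 -(mulrA (s * x)) ss mulr1 -(mulrA s) -(mulrA s).
  have qk : (k %/ p < k)%N by apply: ltn_Pdiv.
  rewrite IH ?mulr0 ?mul0r // divn_gt0 ?(ltnW p_ge2) //.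
  by rewrite dvdn_leq // /dvdn r0.
rewrite -2!(mulrA (s * x)) ranges_orthogonal ?mulr0 ?mul0r // r0 ltn_mod.
exact: ltnW.
Qed.

Lemma fixed_orthogonal a b (x y : Q) : a != b ->
  s * x * star s = x -> s * y * star s = y ->
  x * (u ^+ a * star u ^+ b) * y = 0.
Proof.
have [uU _ _ _] := rel; move=> ab xF yF.
have [lt|lt|/eqP eq] := ltngtP a b; last by rewrite eq in ab.
- have -> : u ^+ a * star u ^+ b = star (u ^+ (b - a)).
    rewrite starX -{1}[a]add0n -{1}(subnKC (ltnW lt)).
    by rewrite unitary_exp_cancel // mul1r.
  apply: (can_inj (@starK R Q)); rewrite !starM starK star0 mulrA.
  by rewrite fixed_exp_orthogonal ?subn_gt0 //; apply: star_fixed.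
- have -> : u ^+ a * star u ^+ b = u ^+ (a - b).
    by rewrite -{1}(subnK (ltnW lt)) -{3}[b]addn0 unitary_exp_cancel // mulr1.
  by rewrite fixed_exp_orthogonal ?subn_gt0.
Qed.
End FixedElements.

(** * Density of a generated star-subalgebra *)

Lemma le_of_le_div (R : realType) (K t e : R[i]) :
  0 <= K -> 0 <= e -> t <= e / (1 + K) -> K * t <= e.
Proof.
move=> K0 e0 te; have K1 : 0 < 1 + K by rewrite ltr_wpDr.
apply: le_trans (ler_wpM2l K0 te) _.
by rewrite mulrA ler_pdivrMr // mulrC ler_wpM2l // lerDr.
Qed.

(** The norm closure of a star-subalgebra is a C*-subalgebra, so if the
    star-subalgebra contains generators, its closure is everything. *)
Lemma generated_dense (R : realType) (Q : cstarAlgType R) (gens P : set Q) :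
  cstar_generated gens -> (gens `<=` P)%classic -> P 1 ->
  (forall (a : R[i]) (x y : Q), P x -> P y -> P (a *: x + y)) ->
  (forall x y : Q, P x -> P y -> P (x * y)) ->
  (forall x : Q, P x -> P (star x)) ->
  forall (x : Q) (e : R[i]), 0 < e -> exists2 y, P y & `|x - y| <= e.
Proof.
move=> gen gensP P1 PL PM PS.
pose D := [set x : Q | forall e : R[i], 0 < e -> exists2 y, P y & `|x - y| <= e]%classic.
have PD x : P x -> D x by move=> Px e e0; exists x; rewrite // subrr normr0 ltW.
have half (e : R[i]) : 0 < e -> 0 < e / 2 by move=> e0; rewrite divr_gt0.
have small (e K : R[i]) : 0 < e -> 0 <= K -> 0 < e / (1 + K).
  by move=> e0 K0; rewrite divr_gt0 // ltr_wpDr.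
suff DT : D = setT by move=> x; have : D x by rewrite DT.
apply: gen; last by move=> x /gensP /PD.
split.
- move=> x clx e e0.
  have [x1 [Dx1 x1x]] := clx _ (nbhsx_ballx x _ (half _ e0)).
  have [y Py yx1] := Dx1 _ (half _ e0); exists y => //.
  move: x1x; rewrite -ball_normE /ball_ /= => /ltW x1x.
  rewrite [e]splitr -(subrK x1 x) -addrA; apply: le_trans (ler_normD _ _) _.
  exact: lerD.
- exact: PD.
- move=> a x y Dx Dy e e0.
  have [x' Px' hx] := Dx _ (small _ _ (half _ e0) (normr_ge0 a)).
  have [y' Py' hy] := Dy _ (half _ e0).
  exists (a *: x' + y'); first exact: PL.
  rewrite opprD addrACA -scalerBr [e]splitr.
  apply: le_trans (ler_normD _ _) (lerD _ hy); rewrite normrZ.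
  exact: le_of_le_div (ltW (half _ e0)) hx.
- move=> x y Dx Dy e e0.
  have [x' Px' hx] := Dx _ (small _ _ (half _ e0) (normr_ge0 y)).
  have [y' Py' hy] := Dy _ (small _ _ (half _ e0) (normr_ge0 x')).
  exists (x' * y'); first exact: PM.
  have -> : x * y - x' * y' = (x - x') * y + x' * (y - y').
    by rewrite mulrBl mulrBr addrA subrK.
  rewrite [e]splitr; apply: le_trans (ler_normD _ _) _; apply: lerD.
    apply: le_trans (cnormM _ _) _; rewrite mulrC.
    exact: le_of_le_div (ltW (half _ e0)) hx.
  apply: le_trans (cnormM _ _) _.
  exact: le_of_le_div (ltW (half _ e0)) hy.
- move=> x Dx e e0; have [y Py hy] := Dx _ e0.
  by exists (star y); [exact: PS | rewrite -starB cnorm_star].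
Qed.

(** * Lacunary sums of powers of the unitary *)

(** By symmetry let [b < a], so that [e < c]. If [b] and [e] were distinct, the
    smaller of them would be the exact exponent of [p] in one of the sides,
    while the other side would be divisible by a higher power. *)
Lemma expn_difference_inj p a b c e : (2 <= p)%N -> a != b ->
  (p ^ b + p ^ c = p ^ a + p ^ e)%N -> a = c /\ b = e.
Proof.
move=> p2.
wlog lt : a b c e / (b < a)%N => [hw ab eq|_ eq].
  have [ba|ba|eab] := ltngtP b a; first exact: hw.
  - by have [|//|-> ->] := hw b a e c ba; rewrite 1?eq_sym.
  - by rewrite eab eqxx in ab.
have pow_ndvd k : ~~ (p ^ k.+1 %| p ^ k)%N.
  by rewrite dvdn_Pexp2l // ltnn.
have ec : (e < c)%N by rewrite -(@ltn_exp2l p) //; move: lt; rewrite -(@ltn_exp2l p) //; lia.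
have [be|eb|be] := ltngtP b e.
- have /negP[] := pow_ndvd b; rewrite -(dvdn_addl _ (n := p ^ c)).
    by rewrite eq dvdn_add // dvdn_exp2l.
  by rewrite dvdn_exp2l // (ltn_trans be).
- have /negP[] := pow_ndvd e; rewrite -(dvdn_addr _ (m := p ^ a)).
    by rewrite -eq dvdn_add // dvdn_exp2l.
  by rewrite dvdn_exp2l // (ltn_trans eb).
- split=> //; apply/eqP; rewrite -(@eqn_exp2l p) //; apply/eqP.
  by move: eq; rewrite be addnC => /addIn.
Qed.

Section LacunarySums.
Variables (R : realType) (Q : cstarAlgType R) (p : nat) (u s : Q).
Hypothesis p_ge2 : (2 <= p)%N.
Hypothesis rel : padic_relations p u s.

Definition lacunary_sum (w : Q) N : Q := \sum_(n < N) w ^+ (p ^ n).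

Lemma star_lacunary_sum w N : star (lacunary_sum w N) = lacunary_sum (star w) N.
Proof. by rewrite star_sum; apply: eq_bigr => n _; rewrite starX. Qed.

Lemma lacunary_sum_fixed (x y : Q) N :
  s * x * star s = x -> s * y * star s = y -> x * lacunary_sum u N * y = 0.
Proof.
move=> xF yF; rewrite mulr_sumr mulr_suml big1 // => n _.
by rewrite (fixed_exp_orthogonal p_ge2 rel) // expn_gt0 (ltnW p_ge2).
Qed.

(** The summands applied to [y] are orthogonal of length [`|y|]; the number of
    summands is taken to be a square only to avoid a square root. *)
Lemma norm_lacunary_sum (y : Q) M : s * y * star s = y ->
  `|star (lacunary_sum u (M * M)) * y| = M%:R * `|y|.
Proof.
move=> yF; have [uU _ _ _] := rel.
apply: (@pexpIrn _ 2); rewrite ?nnegrE ?mulr_ge0 //.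
rewrite exprMn -natrX expnS expn1 -[X in _ = X%:R * _]card_ord.
rewrite star_lacunary_sum mulr_suml (@norm_orthogonal_sum _ _ _ _ _ y) // => i j _ _.
rewrite starM starX starK !mulrA -(mulrA (star y)).
case: eqVneq => [->|ij]; first by rewrite unitary_expVK // mulr1.
rewrite (fixed_orthogonal p_ge2 rel) //; last exact: star_fixed.
by rewrite eqn_exp2l.
Qed.

(** After the diagonal terms are split off, the remaining [N (N - 1)] vectors
    [u^(p^a - p^b) y] are pairwise orthogonal and of the same length, since
    the exponents are distinct. *)
Lemma lacunary_square (y : Q) N : s * y * star s = y ->
  exists off : Q,
  [/\ lacunary_sum u N * star (lacunary_sum u N) * y = y *+ N + off,
      forall x, s * x * star s = x -> x * off = 0 & `|off| <= N%:R * `|y|].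
Proof.
move=> yF; have [uU _ _ _] := rel.
pose f (i : 'I_N * 'I_N) := u ^+ (p ^ i.1) * star u ^+ (p ^ i.2) * y.
exists (\sum_(i | i.1 != i.2) f i); split.
- rewrite star_lacunary_sum /lacunary_sum mulr_suml mulr_suml.
  under eq_bigr do rewrite mulr_sumr mulr_suml.
  rewrite pair_big /= (bigID (fun i => i.1 == i.2)) /=; congr (_ + _).
  rewrite -(pair_big_dep xpredT (fun i j : 'I_N => i == j)
    (fun i j : 'I_N => u ^+ (p ^ i) * star u ^+ (p ^ j) * y)) /=.
  rewrite (eq_bigr (fun=> y)) ?sumr_const ?card_ord // => i _.
  rewrite (big_pred1 i) => [|j]; last by rewrite /= eq_sym.
  by rewrite unitary_expVK // mul1r.
- move=> x xF; rewrite mulr_sumr big1 // => i ii.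
  by rewrite /f mulrA (fixed_orthogonal p_ge2 rel) // eqn_exp2l.
- rewrite -(@ler_pXn2r _ 2) ?nnegrE ?mulr_ge0 // (@norm_orthogonal_sum _ _ _ _ _ y).
    rewrite exprMn -natrX ler_wpM2r ?exprn_ge0 // ler_nat.
    apply: leq_trans (max_card _) _.
    by rewrite card_prod card_ord expnS expn1.
  move=> i j ii jj; rewrite /f !starM !starX !starK.
  rewrite !mulrA -3!(mulrA (star y)).
  have -> : u ^+ (p ^ i.2) * star u ^+ (p ^ i.1) *
      u ^+ (p ^ j.1) * star u ^+ (p ^ j.2) =
      u ^+ (p ^ i.2 + p ^ j.1) * star u ^+ (p ^ i.1 + p ^ j.2).
    by rewrite !exprD -(mulrA (u ^+ _)) unitary_exp_comm // !mulrA.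
  case: eqVneq => [<-|ij].
    by rewrite addnC unitary_expVK // mulr1.
  rewrite (fixed_orthogonal p_ge2 rel) //; last exact: star_fixed.
  apply: contra_neq ij => e.
  have [e1 e2] := expn_difference_inj p_ge2 ii e.
  by apply/eqP; rewrite -pair_eqE /pair_eq -!val_eqE /= e1 e2 !eqxx.
Qed.

Lemma lacunary_sum_intertwine (w : Q) N : `|w| <= 1 -> s * w = w ^+ p * s ->
  `|lacunary_sum w N * s - s * lacunary_sum w N| <= 2.
Proof.
move=> w1 sw; have [_ ss _ _] := rel.
have wk k : `|w ^+ k| <= 1.
  elim: k => [|k IH]; first by rewrite expr0 cnorm1.
  by rewrite exprS cnormM_le1.
have -> : lacunary_sum w N * s - s * lacunary_sum w N =
    (w ^+ (p ^ 0) - w ^+ (p ^ N)) * s.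
  rewrite mulr_suml mulr_sumr -sumrB -[_ - w ^+ (p ^ N)]opprB.
  rewrite -(telescope_sumr (fun n => w ^+ (p ^ n))) // big_mkord mulNr mulr_suml.
  rewrite -sumrN; apply: eq_bigr => n _.
  by rewrite (intertwine_exp _ sw) -expnS -mulrBl -mulNr opprB.
apply: le_trans (cnormM _ _) _; rewrite [X in _ * X](cnorm_isometry ss) mulr1.
apply: le_trans (ler_normB _ _) _.
by rewrite -[X in _ <= X]/(1 + 1 : R[i]) lerD.
Qed.

Definition bounded_commutators (x : Q) := exists C : R[i], forall N,
  `|lacunary_sum u N * x - x * lacunary_sum u N| <= C /\
  `|star (lacunary_sum u N) * x - x * star (lacunary_sum u N)| <= C.

(** Both generators qualify, since [u] commutes with the sums while the
    commutators with [s] telescope to [u - u^(p^N)] times [s]; products and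
    adjoints are handled by the Leibniz rule and by symmetry. *)
Lemma bounded_commutators_dense : cstar_generated [set x | x = u \/ x = s]%classic ->
  forall (x : Q) (e : R[i]), 0 < e ->
  exists2 y, bounded_commutators y & `|x - y| <= e.
Proof.
have [uU ss su _] := rel; have [uu uu'] := uU.
move/generated_dense; apply.
- have u1 : `|u| <= 1 by rewrite cnorm_isometry.
  move=> _ [->|->]; [exists 0 | exists 2] => N; rewrite star_lacunary_sum.
    have comm (w : Q) : GRing.comm w u -> lacunary_sum w N * u = u * lacunary_sum w N.
      move=> wu; rewrite mulr_suml mulr_sumr; apply: eq_bigr => n _.
      exact/commr_sym/commrX/commr_sym.
    by rewrite !comm ?subrr ?normr0 // /GRing.comm uu uu'.
  split; apply: lacunary_sum_intertwine; rewrite ?cnorm_star //.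
  have upK : star u ^+ p * u ^+ p = 1 by apply: unitary_expK.
  by rewrite -[LHS]mul1r -upK -mulrA (mulrA (u ^+ p)) -su -mulrA uu' mulr1.
- by exists 0 => N; rewrite !mulr1 !mul1r !subrr normr0.
- move=> a x y [C hC] [D hD]; exists (`|a| * C + D) => N.
  have [[h1 h2] [k1 k2]] := (hC N, hD N).
  have lin (g : Q) : g * (a *: x + y) - (a *: x + y) * g =
      a *: (g * x - x * g) + (g * y - y * g).
    by rewrite mulrDr mulrDl -scalerAr -scalerAl scalerBr opprD addrACA.
  rewrite !lin; split; apply: le_trans (ler_normD _ _) _;
    by apply: lerD => //; rewrite normrZ ler_wpM2l.
- move=> x y [C hC] [D hD]; exists (C * `|y| + `|x| * D) => N.
  have [[h1 h2] [k1 k2]] := (hC N, hD N).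
  have leibniz (g : Q) : g * (x * y) - (x * y) * g =
      (g * x - x * g) * y + x * (g * y - y * g).
    by rewrite mulrBl mulrBr !mulrA addrA subrK.
  rewrite !leibniz; split; apply: le_trans (ler_normD _ _) _;
    by apply: lerD; apply: le_trans (cnormM _ _) _; rewrite ?ler_wpM2r ?ler_wpM2l.
- move=> x [C hC]; exists C => N; have [h1 h2] := hC N.
  have adj (g : Q) : g * star x - star x * g = star (x * star g - star g * x).
    by rewrite starB !starM starK.
  by rewrite !adj !cnorm_star starK distrC h2 distrC.
Qed.

(** Let [D] be the adjoint of [d], [G] the sum of [N = M^2] powers and [y] an
    approximation of [d] whose commutators with [G] stay bounded. Then
    [N *: (D d D) = D d G G^* D] while [D G d G^* D = 0], and the two right-hand
    sides differ by [O(e N + M)] because [`|G^* D| = M `|d|] and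
    [`|G G^* D| <= 2 N `|d|]. *)
Lemma fixed_eq0 (d : Q) : cstar_generated [set x | x = u \/ x = s]%classic ->
  s * d * star s = d -> d = 0.
Proof.
move=> gen dF; apply/eqP/negP => /negP d0.
have DF := star_fixed dF.
set D := star d in DF.
have nD : `|D| = `|d| by apply: cnorm_star.
set n := `|d| in nD.
have n0 : 0 < n by rewrite normr_gt0.
(* The three error terms below add up to [4 N e n^2], which is half of [N n^3]. *)
pose e : R[i] := n / 8%:R.
have e0 : 0 < e by rewrite divr_gt0 // ltr0n.
have [y [C hC] hy] := bounded_commutators_dense gen d e0.
have C0 : 0 <= C by have [h _] := hC 0%N; apply: le_trans h.
(* For such an [M], the commutator term [C M] is at most [e N]. *)
have [M' hM'] := natR_bound (divr_ge0 C0 (ltW e0)).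
pose M := M'.+1.
have hM : C <= e * M%:R.
  rewrite mulrC -ler_pdivrMr //; apply: le_trans hM' _; by rewrite ler_nat leqnSn.
pose G := lacunary_sum u (M * M).
have nGD : `|star G * D| = M%:R * n by rewrite norm_lacunary_sum // nD.
have nDG : `|D * G| = M%:R * n.
  by rewrite -cnorm_star starM /D starK norm_lacunary_sum.
have [off [GG offF noff]] := lacunary_square (M * M) DF.
have nGGD : `|G * (star G * D)| <= (M * M)%:R * n *+ 2.
  rewrite mulrA GG mulr2n; apply: le_trans (ler_normD _ _) _.
  by rewrite normrMn nD -[n *+ _]mulr_natl lerD2l -nD.
have main : (D * d * D) *+ (M * M) =
    D * (d - y) * (G * (star G * D)) - D * (G * y - y * G) * (star G * D)
    - D * G * (d - y) * (star G * D).
  have -> : (D * d * D) *+ (M * M) = D * d * (G * (star G * D)).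
    rewrite [G * _]mulrA GG mulrDr -[D * d * off]mulrA (offF d dF) mulr0 addr0.
    by rewrite mulrnAr.
  have z : D * G * d * (star G * D) = 0.
    by rewrite (lacunary_sum_fixed _ DF dF) mul0r.
  rewrite !mulrBr !mulrBl z sub0r opprK !mulrA opprB.
  by rewrite addrA subrK subrK.
have up : `|(D * d * D) *+ (M * M)| <= (M * M)%:R * (n ^+ 2 * e * 4%:R).
  rewrite main.
  have b1 : `|D * (d - y) * (G * (star G * D))| <= n * e * ((M * M)%:R * n *+ 2).
    apply: le_trans (cnormM _ _) _; apply: ler_pM => //.
    by apply: le_trans (cnormM _ _) _; rewrite nD ler_wpM2l // ltW.
  have b2 : `|D * (G * y - y * G) * (star G * D)| <= n * C * (M%:R * n).
    apply: le_trans (cnormM _ _) _; rewrite nGD ler_wpM2r ?mulr_ge0 ?(ltW n0) //.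
    apply: le_trans (cnormM _ _) _; rewrite nD ler_wpM2l ?(ltW n0) //.
    by have [] := hC (M * M)%N.
  have b3 : `|D * G * (d - y) * (star G * D)| <= M%:R * n * e * (M%:R * n).
    apply: le_trans (cnormM _ _) _; rewrite nGD ler_wpM2r ?mulr_ge0 ?(ltW n0) //.
    by apply: le_trans (cnormM _ _) _; rewrite nDG ler_wpM2l // mulr_ge0 // ltW.
  have b2' : n * C * (M%:R * n) <= n * (e * M%:R) * (M%:R * n).
    by rewrite ler_wpM2r ?mulr_ge0 ?(ltW n0) // ler_wpM2l // ltW.
  apply: le_trans (ler_normB _ _) _.
  apply: le_trans (lerD (ler_normB _ _) (lexx _)) _.
  apply: le_trans (lerD (lerD b1 (le_trans b2 b2')) b3) _.
  by rewrite natrM le_eqVlt; apply/orP; left; apply/eqP; ring.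
have low : n ^+ 3 <= `|D * d * D|.
  rewrite -(ler_pM2r n0).
  have -> : n ^+ 3 * n = `|D * d * (D * d)|.
    rewrite cnorm_selfadjoint_sqr ?starM ?starK // cnorm_star_mul -/n; ring.
  by rewrite mulrA cnormM.
move: up; rewrite normrMn -[X in X <= _]mulr_natl.
rewrite ler_pM2l ?ltr0n ?muln_gt0 // => /(le_trans low).
have -> : n ^+ 2 * e * 4%:R = n ^+ 3 / 2%:R by rewrite /e; field.
by apply/negP; rewrite lt_geF // ltr_pdivrMr // ltr_pMr ?exprn_gt0 // ltr1n.
Qed.

End LacunarySums.

(** * Extensions of the same automorphism *)

Lemma star_hom0 (R : realType) (B C : cstarAlgType R) (f : B -> C) :
  star_hom f -> f 0 = 0.
Proof.
by case=> lin _ _; rewrite -{1}(addNr (0 : B)) -scaleN1r lin scaleN1r addNr.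
Qed.

Lemma star_homX (R : realType) (B C : cstarAlgType R) (f : B -> C) x n :
  star_hom f -> f (x ^+ n) = f x ^+ n.
Proof.
by case=> _ [f1 fM] _; elim: n => [|n IH]; rewrite ?expr0 // !exprS fM IH.
Qed.

Lemma star_hom_padic (R : realType) (p : nat) (B C : cstarAlgType R)
    (f : B -> C) (u s : B) :
  star_hom f -> padic_relations p u s -> padic_relations p (f u) (f s).
Proof.
move=> fH [[uu uu'] ss su sum1]; have [lin [f1 fM] fS] := fH.
split.
- by split; rewrite -fS -fM ?uu ?uu' f1.
- by rewrite /Defs.isometry -fS -fM ss f1.
- by rewrite -fM su fM star_homX.
- rewrite -f1 -sum1.
  have fD x y : f (x + y) = f x + f y by rewrite -[x]scale1r lin !scale1r.
  rewrite (big_morph _ fD (star_hom0 fH)); apply: eq_bigr => i _.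
  by rewrite !fM !(star_homX _ _ fH) !fS.
Qed.

(** Put [z = v * star w]. On the range of [w^i t] with [0 < i < p] it is the
    identity, because [z w^i t = v w^(i-1) t = v^i t = w^i t]. On the range of
    [t] it is [t z (star t)], because [star w * t = w^(p-1) t (star w)]. *)
Lemma padic_unitary_ratio (p : nat) (R : realType) (Q : cstarAlgType R)
    (v w t : Q) : (2 <= p)%N ->
  padic_relations p v t -> padic_relations p w t ->
  (forall i : 'I_p, v ^+ i * t = w ^+ i * t) ->
  t * (v * star w - 1) * star t = v * star w - 1.
Proof.
move=> p2 [vU _ tv _] [[ww ww'] _ tw sum1] vw.
have p0 : (0 < p)%N by apply: ltnW.
have p1p : (p.-1 < p)%N by rewrite prednK.
have wt : star w * t = w ^+ p.-1 * t * star w.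
  have e : w * (w ^+ p.-1 * t * star w) = t.
    by rewrite !mulrA -exprS prednK // -tw -mulrA ww' mulr1.
  by rewrite -{1}e mulrA ww mul1r.
have e0 : v * star w * (t * star t) = t * (v * star w) * star t.
  rewrite mulrA -[v * star w * t]mulrA wt !mulrA.
  rewrite -[v * w ^+ p.-1 * t]mulrA -(vw (Ordinal p1p)) /= mulrA -exprS prednK //.
  by rewrite -tv.
have ei i : (0 < i < p)%N -> v * star w * (w ^+ i * t * star t * star w ^+ i) =
    w ^+ i * t * star t * star w ^+ i.
  case: i => // i /andP[_ ip]; rewrite {1}exprS !mulrA -(mulrA v) ww mulr1.
  rewrite -(mulrA v) -(vw (Ordinal (ltnW ip))) /= mulrA -exprS.
  by rewrite (vw (Ordinal ip)).
have e1 : v * star w * (1 - t * star t) = 1 - t * star t.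
  rewrite -sum1 -(prednK p0) big_ord_recl /= !expr0 mul1r mulr1 addrAC subrr.
  rewrite add0r mulr_sumr; apply: eq_bigr => i _; apply: ei.
  by rewrite /bump /=; have := ltn_ord i; lia.
rewrite mulrBr mulr1 mulrBl -e0.
have -> : v * star w - 1 =
    v * star w * (t * star t) + v * star w * (1 - t * star t) - 1.
  by rewrite -mulrDr addrC [t * _ + _]addrC subrK mulr1 addrC.
by rewrite e1 -addrA [_ - 1]addrAC subrr sub0r.
Qed.

Unset Implicit Arguments.

Theorem lemma5p4 (R : realType) (p : nat) (p_ge2 : (2 <= p)%N)
    (Q : cstarAlgType R) (u s : Q) (HQ : is_padic_algebra p u s)
    (Op : cstarAlgType R) (T : 'I_p -> Op) (HO : is_cuntz_algebra T)
    (iota : Op -> Q) (Hiota : is_cuntz_inclusion T u s iota)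
    (A : 'M[R[i]]_p) (HA : A \is unitarymx)
    (lambda : Op -> Op) (Hlambda : is_bogolubov T A lambda)
    (alpha beta : Q -> Q)
    (Halpha : automorphism_extension iota lambda alpha)
    (Hbeta : automorphism_extension iota lambda beta) :
  forall x : Q, alpha x = beta x.
Proof.
have [rel gen univ] := HQ; have [_ _ iotaT] := Hiota.
have [[alphaH _] alphaE] := Halpha.
have [[betaH [beta' betaK betaK']] betaE] := Hbeta.
have agree (i : 'I_p) : alpha (u ^+ i * s) = beta (u ^+ i * s).
  by rewrite -iotaT alphaE betaE.
have agree_s : alpha s = beta s.
  by have := agree (Ordinal (ltnW p_ge2)); rewrite /= mul1r.
have alpha_rel := star_hom_padic alphaH rel.
have beta_rel := star_hom_padic betaH rel.
have [_ [_ aM] _] := alphaH; have [lin [b1 bM] bS] := betaH.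
pose d := beta' (alpha u * star (beta u) - 1).
have dF : s * d * star s = d.
  apply: (can_inj betaK); rewrite !bM bS betaK'.
  apply: (padic_unitary_ratio p_ge2 _ beta_rel).
    by rewrite -agree_s; exact: alpha_rel.
  move=> i; have := agree i.
  by rewrite aM bM (star_homX _ _ alphaH) (star_homX _ _ betaH) agree_s.
have d0 := fixed_eq0 p_ge2 rel gen dF.
have agree_u : alpha u = beta u.
  have := betaK' (alpha u * star (beta u) - 1); rewrite -/d d0.
  rewrite star_hom0 // => /esym/subr0_eq e; have [[uu _] _ _ _] := beta_rel.
  by rewrite -[LHS]mulr1 -uu mulrA e mul1r.
have [f [_ f_uniq]] := univ Q (beta u) (beta s) beta_rel.
have -> : alpha = f by apply/esym/f_uniq.
by have -> : beta = f by apply/esym/f_uniq.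
Qed.
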